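(* Let $n\ge 2$. The $0$-maximal polynomials of degree $n$ are exactly the following polynomials: (i) if $n=2m$ with $m\ge 1$: $z^{2m}+e^{i2\theta}z$, where $\theta\in\mathbb{R}$; (ii) if $n=2m+1$ with $m\ge 1$: $z^{2m+1}+\lambda e^{i\theta}z^{m+1}+e^{i2\theta}z$, where $\lambda,\theta\in\mathbb{R}$ and $|\lambda|\le \frac{2\sqrt{2m+1}}{m+1}$.
   Context: For a polynomial $p$, $Z(p)$ denotes its set of complex zeros. $S(n,0)$ is the set of all monic complex polynomials of degree $n$ having all their zeros in the closed unit disk and having at least one zero at $0$. For $p\in S(n,0)$ put $|p|_0=\min_{w\in Z(p')}|w|$. A polynomial $p\in S(n,0)$ is called $0$-maximal (of degree $n$) if $|p|_0\ge |q|_0$ for every $q\in S(n,0)$. *)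

(* Defs.v *)
From mathcomp Require Import all_boot all_order all_algebra.
From mathcomp Require Export complex.
From mathcomp Require Import boolp classical_sets reals trigo.
Set Implicit Arguments.
Unset Strict Implicit.
Unset Printing Implicit Defensive.
Import Order.TTheory GRing.Theory Num.Theory.
Local Open Scope classical_set_scope.
Local Open Scope complex_scope.
Local Open Scope ring_scope.

Definition expi (R : realType) (t : R) : R[i] := cos t +i* sin t.

(* The norm of R[i] takes its values in R[i] itself, as real elements. *)
Definition modulus (R : realType) (z : R[i]) : R := complex.Re `|z|.

Definition zeros (R : realType) (p : {poly R[i]}) : set R[i] :=
  [set z | root p z].

(* S(n,0); recall that [size p] is one more than the degree of [p]. *)
Definition S0 (R : realType) (n : nat) : set {poly R[i]} :=
  [set p | [/\ p \is monic, size p = n.+1,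
               forall z, zeros p z -> modulus z <= 1
             & zeros p 0]].

(* |p|_0.  The infimum is a minimum as soon as p has degree at least 2,
   see [abs0_is_min] below. *)
Definition abs0 (R : realType) (p : {poly R[i]}) : R :=
  inf [set modulus w | w in zeros p^`()].

Definition zero_maximal (R : realType) (n : nat) (p : {poly R[i]}) : Prop :=
  S0 n p /\ forall q : {poly R[i]}, S0 n q -> abs0 q <= abs0 p.

Lemma abs0_is_min (R : realType) (p : {poly R[i]}) : (2 < size p)%N ->
  exists2 w, zeros p^`() w &
    abs0 p = modulus w /\ forall v, zeros p^`() v -> modulus w <= modulus v.
Proof.
move=> sp; have sp' : size p^`() = (size p).-1.
  case E : (size p) sp => [|[|[|k]]] // _; apply/eqP; rewrite eqn_leq.
  apply/andP; split.
    by rewrite -ltnS -[X in (_ < X)%N]E lt_size_deriv// -size_poly_gt0 E.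
  rewrite ltnNge; apply/negP => /leq_sizeP/(_ k.+1 (leqnn _))/eqP.
  rewrite coef_deriv mulrn_eq0 /= => pk0.
  have := lead_coef_eq0 p; rewrite -size_poly_eq0 lead_coefE E /=.
  by rewrite pk0.
have [rs prs] := closed_field_poly_normal p^`().
have nz : p^`() != 0 by rewrite -size_poly_gt0 sp'; case: (size p) sp => [|[]].
have rsE z : root p^`() z = (z \in rs).
  by rewrite prs rootZ ?lead_coef_eq0// root_prod_XsubC.
have [x0 x0rs] : exists x, x \in rs.
  case: rs prs rsE => [prs _|x rs _ _]; last by exists x; rewrite mem_head.
  have : (size p^`() <= 1)%N by rewrite prs big_nil (leq_trans (size_scale_leq _ _)) ?size_poly1.
  by rewrite sp'; case: (size p) sp => [|[|[]]].
have [w wrs wmin] : exists2 w, w \in rs & forall v, v \in rs -> modulus w <= modulus v.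
  case: (@arg_minP _ _ _ (SeqSub x0rs) xpredT (fun i => modulus (val i)) isT).
  by move=> i _ h; exists (val i) => [|v vrs]; [exact: valP | exact: (h (SeqSub vrs))].
exists w; first by rewrite /zeros/= rsE.
split; last by move=> v; rewrite /zeros/= rsE; exact: wmin.
apply/eqP; rewrite eq_le; apply/andP; split.
  apply: ge_inf; last by exists w => //; rewrite /zeros/= rsE.
  by exists (modulus w) => _ [v + <-]; rewrite /zeros/= rsE; exact: wmin.
apply: lb_le_inf; first by exists (modulus w), w => //; rewrite /zeros/= rsE.
by move=> _ [v + <-]; rewrite /zeros/= rsE; exact: wmin.
Qed.

(* Main.v *)
(* The critical points of [p = z q] multiply, up to sign, to [q(0) / n], and
   [|q(0)| <= 1]; hence [|p|_0 ^ (n-1) <= 1/n], a bound attained by [z^n + u z].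
   Thus [p] is 0-maximal iff all zeros of [q] have modulus 1 and all critical
   points have modulus [r], [r ^ (n-1) = 1/n].  A polynomial whose zeros lie on
   a circle is self-inversive; comparing this symmetry of the coefficients [q_k]
   for [q] and for [p'], with [N = n-1], gives
   [(N+1-k) q_k = (N+1) (k+1) r^(2k) q_k], and strict log-convexity of
   [s |-> (N+2+s) / (N+2-s)] then forces [q_k = 0] unless [k] is [0], [N/2] or
   [N].  For [N = 2m] the self-inversive trinomials are [z^N + l e^(it) z^m +
   e^(2it)] with [l] real, and zeros and critical points reduce to real
   quadratics. *)
Require Import Defs.
From mathcomp Require Import all_boot all_order all_algebra.
From mathcomp Require Import reals trigo ring lra zify.
Set Implicit Arguments.
Unset Strict Implicit.
Unset Printing Implicit Defensive.
Import Order.TTheory GRing.Theory Num.Theory.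
Local Open Scope complex_scope.
Local Open Scope ring_scope.

(** * Zeros, their product and the constant coefficient *)

Lemma roots_of_factorization (F : fieldType) (f : {poly F}) (rs : seq F) :
  f != 0 -> f = lead_coef f *: \prod_(z <- rs) ('X - z%:P) ->
  size rs = (size f).-1 /\ (forall z, root f z = (z \in rs)).
Proof.
move=> f0 fE; have lf0 : lead_coef f != 0 by rewrite lead_coef_eq0.
split; first by rewrite fE size_scale // size_prod_XsubC.
by move=> z; rewrite fE rootZ // root_prod_XsubC.
Qed.

Lemma norm_coef0_factored (C : numClosedFieldType) (f : {poly C}) (rs : seq C) :
  f = lead_coef f *: \prod_(z <- rs) ('X - z%:P) ->
  `|f`_0| = `|lead_coef f| * \prod_(z <- rs) `|z|.
Proof.
move=> fE; rewrite {1}fE -horner_coef0 hornerZ normrM horner_prod normr_prod.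
by congr (_ * _); apply: eq_bigr => z _; rewrite !hornerE normrN.
Qed.

Lemma prodr_const_seq (K : pzSemiRingType) (I : Type) (s : seq I) (a : K) :
  \prod_(i <- s) a = a ^+ size s.
Proof. by rewrite big_const_seq count_predT iter_mulr_1. Qed.

Lemma le_norm_coef0 (C : numClosedFieldType) (f : {poly C}) (a : C) :
  f != 0 -> 0 <= a -> (forall z, root f z -> a <= `|z|) ->
  `|lead_coef f| * a ^+ (size f).-1 <= `|f`_0|.
Proof.
move=> f0 a0 fa; have [rs fE] := closed_field_poly_normal f.
have [<- rsE] := roots_of_factorization f0 fE.
rewrite (norm_coef0_factored fE) ler_wpM2l // -prodr_const_seq.
rewrite big_seq [leRHS]big_seq; apply: ler_prod => z.
by rewrite a0 -rsE; exact: fa.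
Qed.

Lemma ge_norm_coef0 (C : numClosedFieldType) (f : {poly C}) (a : C) :
  f != 0 -> (forall z, root f z -> `|z| <= a) ->
  `|f`_0| <= `|lead_coef f| * a ^+ (size f).-1.
Proof.
move=> f0 fa; have [rs fE] := closed_field_poly_normal f.
have [<- rsE] := roots_of_factorization f0 fE.
rewrite (norm_coef0_factored fE) ler_wpM2l // -prodr_const_seq.
rewrite big_seq [leRHS]big_seq; apply: ler_prod => z.
by rewrite normr_ge0 -rsE; exact: fa.
Qed.

Lemma root_quotient (C : numClosedFieldType) (f : {poly C}) (z : C) :
  f != 0 -> root f z -> exists g : {poly C},
  [/\ g != 0, size f = (size g).+1, lead_coef f = lead_coef g,
      `|f`_0| = `|z| * `|g`_0| & forall w, root g w -> root f w].
Proof.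
move=> f0 /factor_theorem [g fE]; exists g.
have g0 : g != 0 by apply: contraNneq f0 => g0; rewrite fE g0 mul0r.
split => //.
- by rewrite fE size_Mmonic ?monicXsubC // size_XsubC addn2.
- by rewrite fE lead_coef_Mmonic ?monicXsubC.
- by rewrite fE -!horner_coef0 hornerM hornerXsubC sub0r normrM normrN mulrC.
- by move=> w gw; rewrite fE rootM gw.
Qed.

(** Equality case of [le_norm_coef0]: once X - z is divided out, each remaining zero still
    contributes a factor at least [a], which leaves at most [a] for |z|. *)
Lemma norm_root_of_le (C : numClosedFieldType) (f : {poly C}) (a : C) :
  f != 0 -> 0 < a -> (forall z, root f z -> a <= `|z|) ->
  `|f`_0| <= `|lead_coef f| * a ^+ (size f).-1 ->
  forall z, root f z -> `|z| = a.
Proof.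
move=> f0 a0 fa fle z fz; apply/le_anti; rewrite fa // andbT.
have [g [g0 sg lg gf rg]] := root_quotient f0 fz.
have gge := le_norm_coef0 g0 (ltW a0) (fun w h => fa w (rg w h)).
have sg' : (size g = (size g).-1.+1)%N by rewrite prednK // size_poly_gt0.
have lpos : 0 < `|lead_coef g| * a ^+ (size g).-1.
  by rewrite mulr_gt0 ?exprn_gt0 // normr_gt0 lead_coef_eq0.
rewrite -(ler_pM2r lpos); apply: le_trans (ler_wpM2l (normr_ge0 _) gge) _.
by rewrite -gf; apply: le_trans fle _; rewrite lg sg /= {1}sg' exprS mulrCA.
Qed.

(** Equality case of [ge_norm_coef0], by the same division with the inequalities reversed. *)
Lemma norm_root_of_ge (C : numClosedFieldType) (f : {poly C}) (a : C) :
  f != 0 -> 0 < a -> (forall z, root f z -> `|z| <= a) ->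
  `|lead_coef f| * a ^+ (size f).-1 <= `|f`_0| ->
  forall z, root f z -> `|z| = a.
Proof.
move=> f0 a0 fa fle z fz; apply/le_anti; rewrite fa //=.
have [g [g0 sg lg gf rg]] := root_quotient f0 fz.
have gge := ge_norm_coef0 g0 (fun w h => fa w (rg w h)).
have sg' : (size g = (size g).-1.+1)%N by rewrite prednK // size_poly_gt0.
have lpos : 0 < `|lead_coef g| * a ^+ (size g).-1.
  by rewrite mulr_gt0 ?exprn_gt0 // normr_gt0 lead_coef_eq0.
rewrite -(ler_pM2r lpos); apply: le_trans _ (ler_wpM2l (normr_ge0 z) gge).
by rewrite -gf; apply: le_trans _ fle; rewrite lg sg /= {2}sg' exprS mulrCA.
Qed.

(** * Self-inversive polynomials *)

(** [t] is the squared radius of the circle. Induction on the zeros: for (X - a) f the identity at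
    k+1 combines those for f at k and k+1, through a * conj a = t. *)
Lemma self_inversive_prod (C : numClosedFieldType) (t : C) (rs : seq C) (k : nat) :
  (forall z, z \in rs -> z * z^* = t) -> (k <= size rs)%N ->
  let f := \prod_(z <- rs) ('X - z%:P) in
  f`_0 * (f`_(size rs - k))^* = f`_k * t ^+ k.
Proof.
elim: rs k => [|a rs IH] k rst ks /=.
  by move: ks; rewrite leqn0 => /eqP ->; rewrite big_nil !coefE conjC1 expr0.
have at_ : a * a^* = t by apply: rst; rewrite mem_head.
have {}IH j : (j <= size rs)%N ->
    let f := \prod_(z <- rs) ('X - z%:P) in
    f`_0 * (f`_(size rs - j))^* = f`_j * t ^+ j.
  by apply: IH => z zrs; apply: rst; rewrite inE zrs orbT.
rewrite big_cons; set f := \prod_(z <- rs) _ in IH *; move: IH => /= IH.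
have sf : size f = (size rs).+1 by rewrite size_prod_XsubC.
have fbig : f`_(size rs).+1 = 0 by rewrite nth_default // sf.
have flead : f`_(size rs) = 1.
  by have := lead_coef_prod_XsubC rs xpredT id; rewrite lead_coefE -/f sf.
rewrite mulrBl !coefE /= sub0r.
case: k ks => [_|k /= ks]; first by rewrite subn0 /= flead fbig mulr0 subr0 conjC1 expr0 sub0r.
rewrite subSS rmorphB rmorphM /=; have IHk := IH k ks.
(* [e] is the coefficient of X * f at [size rs - k]. For k = [size rs] it is 0, and the coefficient
   of f at k+1 is then out of range, hence 0 as well. *)
set e := (if _ then _ else _); have IHe : f`_0 * e^* = f`_k.+1 * t ^+ k.+1.
  rewrite /e; have [j0|jn0] := eqVneq (size rs - k)%N 0%N.
    have -> : k = size rs by lia.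
    by rewrite fbig conjC0 mulr0 mul0r.
  by rewrite -IH; [congr (_ * (f`_ _)^*); lia | lia].
transitivity (- a * (f`_0 * e^*) + a * a^* * (f`_0 * (f`_(size rs - k))^*)).
  by ring.
by rewrite IHe IHk at_ exprS; ring.
Qed.

Lemma self_inversive (C : numClosedFieldType) (t : C) (f : {poly C}) (k : nat) :
  f != 0 -> (forall z, root f z -> z * z^* = t) -> (k <= (size f).-1)%N ->
  f`_0 * (f`_((size f).-1 - k))^* = (lead_coef f)^* * f`_k * t ^+ k.
Proof.
move=> f0 ft; have [rs fE] := closed_field_poly_normal f.
have [<- rsE] := roots_of_factorization f0 fE => krs.
have := self_inversive_prod (fun z h => ft z (etrans (rsE z) h)) krs.
move=> /= E; rewrite fE !coefZ -fE rmorphM /=.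
rewrite mulrACA E; ring.
Qed.

(** * Degree and leading coefficient of a derivative *)

Lemma size_deriv_num (K : numDomainType) (p : {poly K}) :
  size p^`() = (size p).-1.
Proof.
have [->|p0] := eqVneq p 0; first by rewrite deriv0 size_poly0.
apply/eqP; rewrite eqn_leq; apply/andP; split.
  by rewrite -ltnS prednK ?size_poly_gt0 // lt_size_deriv.
case E : (size p) => [|[|k]] //=; rewrite ltnNge; apply/negP.
move=> /leq_sizeP/(_ k (leqnn _))/eqP; rewrite coef_deriv mulrn_eq0 /=.
by have := lead_coef_eq0 p; rewrite lead_coefE E /= => ->; apply/negP.
Qed.

Lemma lead_coef_deriv_num (K : numDomainType) (p : {poly K}) :
  lead_coef p^`() = lead_coef p *+ (size p).-1.
Proof.
rewrite !lead_coefE size_deriv_num coef_deriv.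
have [sp|sp] := leqP (size p) 1; last by case: (size p) sp => [|[]].
rewrite [X in X *+ _ = _]nth_default; last by case: (size p) sp => [|[]].
by have -> : ((size p).-1 = 0)%N by case: (size p) sp => [|[]].
Qed.

(** * Strict log-convexity and the excluded indices *)

(** Since log a is strictly convex and vanishes at 0, the slope log a(s) / s is strictly increasing.
    Integer powers replace logarithms and roots. *)
Lemma log_convex_pow_lt (K : realFieldType) (a : nat -> K) (N : nat) :
  a 0 = 1 -> (forall s, (s <= N)%N -> 0 < a s) ->
  (forall s, (s.+2 <= N)%N -> a s.+1 ^+ 2 < a s * a s.+2) ->
  forall s, (0 < s < N)%N -> a s ^+ N < a N ^+ s.
Proof.
move=> a0 apos aconv.
have step s : (0 < s < N)%N -> a s ^+ s.+1 < a s.+1 ^+ s.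
  elim: s => // s IH /= sN; have [s0|s_gt0] := posnP s.
    by have := aconv 0 ltac:(lia); rewrite s0 a0 mul1r expr1.
  have {}IH := IH ltac:(lia).
  have h1 := apos s.+1 ltac:(lia); have h2 := apos s.+2 ltac:(lia).
  have h0 := apos s ltac:(lia).
  (* After multiplication by a(s+1)^s, the left side is a(s+1)^(2(s+1)); convexity bounds it by
     (a(s) a(s+2))^(s+1), and the induction hypothesis bounds a(s)^(s+1). *)
  rewrite -(ltr_pM2l (exprn_gt0 s h1)) -exprD.
  have -> : (s + s.+2 = 2 * s.+1)%N by lia.
  rewrite exprM; apply: (@lt_trans _ _ ((a s * a s.+2) ^+ s.+1)).
    by rewrite ltrXn2r ?aconv ?exprn_ge0 // ltW.
  by rewrite exprMn ltr_pM2r ?exprn_gt0.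
suff H M s : (0 < s)%N -> (s + M.+1 <= N)%N -> a s ^+ (s + M.+1) < a (s + M.+1)%N ^+ s.
  move=> s /andP[s0 sN]; have -> : N = (s + (N - s).-1.+1)%N by lia.
  by apply: H => //; lia.
move=> s0; elim: M => [|M IH] sMN; first by rewrite addn1 step //; lia.
have {}IH := IH ltac:(lia); set L := (s + M.+1)%N in IH *.
have -> : (s + M.+2 = L.+1)%N by rewrite /L; lia.
have aL := apos L ltac:(lia); have aL1 := apos L.+1 ltac:(lia).
have as_ := apos s ltac:(lia).
have L0 : (0 < L)%N by rewrite /L; lia.
(* Raising to the power [L] allows the chain a(s)^(L(L+1)) < a(L)^(s(L+1)) < a(L+1)^(sL). *)
rewrite -(@ltr_pXn2r _ L) ?nnegrE ?exprn_ge0 ?ltW //.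
apply: (@lt_trans _ _ ((a L ^+ s) ^+ L.+1)).
  by rewrite [X in X < _]exprAC ltrXn2r ?exprn_ge0 // ltW.
rewrite [X in X < _]exprAC [X in _ < X]exprAC ltrXn2r ?exprn_ge0 ?(ltW aL) -?lt0n //.
by apply: step; lia.
Qed.

(** Put a(s) = (N+2+s)/(N+2-s), so that a(N-2k) = (N+1-k)/(k+1) and a(N) = N+1. The N-th power of
    the excluded equality would read a(N-2k)^N = a(N)^(N-2k), against [log_convex_pow_lt]. *)
Lemma symmetric_index_neq (K : realFieldType) (N k : nat) (t : K) :
  (0 < k)%N -> (2 * k < N)%N -> t ^+ N = N.+1%:R ^- 2 ->
  (N.+1 - k)%:R <> N.+1%:R * k.+1%:R * t ^+ k.
Proof.
move=> k0 kN tN E.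
pose d : K := N.+2%:R; pose a (s : nat) := (d + s%:R) / (d - s%:R).
have dpos s : (s <= N)%N -> 0 < d - s%:R by move=> sN; rewrite subr_gt0 ltr_nat; lia.
have dpos' s : 0 < d + s%:R by rewrite -natrD ltr0n.
have := @log_convex_pow_lt K a N _ _ _ (N - 2 * k)%N ltac:(lia).
have aE : a (N - 2 * k)%N = (N.+1 - k)%:R / k.+1%:R.
  rewrite /a /d -natrD -natrB; last lia.
  have -> : (N.+2 + (N - 2 * k) = 2 * (N.+1 - k))%N by lia.
  have -> : (N.+2 - (N - 2 * k) = 2 * k.+1)%N by lia.
  by rewrite !natrM -mulf_div divff ?mul1r // pnatr_eq0.
have aN : a N = N.+1%:R.
  rewrite /a /d -natrD -natrB; last lia.
  have -> : (N.+2 + N = 2 * N.+1)%N by lia.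
  have -> : (N.+2 - N = 2)%N by lia.
  by rewrite natrM mulrC mulKf // pnatr_eq0.
have n0 : N.+1%:R != 0 :> K by rewrite pnatr_eq0.
have -> : a (N - 2 * k)%N ^+ N = a N ^+ (N - 2 * k).
  rewrite aE aN E [_ * t ^+ k]mulrAC mulfK ?pnatr_eq0 // exprMn exprAC tN.
  move: n0; set b := N.+1%:R => n0; have NE : (N = (N - 2 * k) + 2 * k)%N by lia.
  by rewrite exprVn -exprM {1}NE exprD mulfK // expf_neq0.
rewrite ltxx => H; apply/notF/H => {H}.
- by rewrite /a subr0 addr0 divff // /d pnatr_eq0.
- by move=> s sN; rewrite divr_gt0 ?dpos.
- move=> s sN; have h1 := dpos s ltac:(lia); have h2 := dpos s.+1 ltac:(lia).
  have h3 := dpos s.+2 sN; rewrite /a exprMn exprVn mulf_div.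
  rewrite ltr_pdivrMr ?exprn_gt0 // mulrAC ltr_pdivlMr ?mulr_gt0 //.
  have hs : 0 <= s%:R :> K by [].
  have hd : 0 < d by rewrite ltr0n.
  move: h1 h2 h3 hs; rewrite -[s.+2]addn2 -[s.+1]addn1 !natrD => h1 h2 h3 hs.
  (* Centred at s+1, the convexity inequality is x^2 (y^2 - 1) < y^2 (x^2 - 1), that is y^2 <
     x^2. *)
  set x := d + (s%:R + 1); set y := d - (s%:R + 1).
  have -> : d + s%:R = x - 1 by rewrite /x; ring.
  have -> : d - s%:R = y + 1 by rewrite /y; ring.
  have -> : d + (s%:R + 2) = x + 1 by rewrite /x; ring.
  have -> : d - (s%:R + 2) = y - 1 by rewrite /y; ring.
  have : y ^+ 2 < x ^+ 2 by rewrite ltrXn2r // ?ltW // /x /y; lra.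
  by nra.
Qed.

(** * The sharp bound on |p|_0 and its equality case *)

Lemma modulusE (R : realType) (z : R[i]) : (modulus z)%:C = `|z|.
Proof. by rewrite /modulus normc_def. Qed.

Lemma modulus_ge0 (R : realType) (z : R[i]) : 0 <= modulus z.
Proof. by rewrite -ler0c modulusE. Qed.

Lemma modulus_pow_eq (R : realType) (z : R[i]) (N n : nat) :
  (modulus z ^+ N = n%:R^-1) <-> (`|z| ^+ N = n%:R^-1).
Proof.
rewrite -modulusE -rmorphXn; split => [->|H]; first by rewrite fmorphV rmorph_nat.
by apply: (@complexI R); rewrite H fmorphV rmorph_nat.
Qed.

Lemma S0_factor (R : realType) (N : nat) (p : {poly R[i]}) : S0 N.+1 p ->
  exists q : {poly R[i]}, [/\ p = q * 'X, q \is monic, size q = N.+1 &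
    forall z, root q z -> `|z| <= 1].
Proof.
case=> pm sp pz /factor_theorem[q]; rewrite subr0 => pE; exists q.
have qm : q \is monic by rewrite -(monicMr _ (monicX _)) -pE.
split => //.
  by move: sp; rewrite pE size_mulX ?monic_neq0 // => -[].
by move=> z qz; rewrite -modulusE lecR; apply: pz; rewrite /zeros /= pE rootM qz.
Qed.

Section CriticalPoints.
Variables (R : realType) (N : nat) (p q : {poly R[i]}).
Hypotheses (pE : p = q * 'X) (qm : q \is monic) (sq : size q = N.+1).

Lemma deriv_mulX_facts :
  [/\ size p = N.+2, size p^`() = N.+1, lead_coef p^`() = N.+1%:R,
      p^`() != 0 & p^`()`_0 = q`_0].
Proof.
have sp : size p = N.+2 by rewrite pE size_mulX ?monic_neq0 // sq.
have pm : p \is monic by rewrite pE monicMr ?monicX.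
have sp' : size p^`() = N.+1 by rewrite size_deriv_num sp.
split => //; first by rewrite lead_coef_deriv_num (monicP pm) sp.
  by rewrite -size_poly_eq0 sp'.
by rewrite coef_deriv pE coefMX.
Qed.

Lemma norm_lead_coef_deriv : `|lead_coef p^`()| = N.+1%:R.
Proof. by have [_ _ -> _ _] := deriv_mulX_facts; rewrite ger0_norm. Qed.

Lemma le_abs0_pow (a : R[i]) : 0 <= a ->
  (forall z, root q z -> `|z| <= 1) ->
  (forall w, root p^`() w -> a <= `|w|) ->
  N.+1%:R * a ^+ N <= `|q`_0| /\ `|q`_0| <= 1.
Proof.
move=> a0 q1 pa; have [sp sp' lp' p'0 c0] := deriv_mulX_facts; split.
  by have := le_norm_coef0 p'0 a0 pa; rewrite norm_lead_coef_deriv sp' c0.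
have := ge_norm_coef0 (monic_neq0 qm) q1.
by rewrite (monicP qm) normr1 expr1n mul1r.
Qed.

(** The hypothesis on [a] closes the chain of [le_abs0_pow], so |q(0)| = 1 and both equality cases
    apply: one to the critical points, the other to the zeros of [q]. *)
Lemma extremal_zeros_norm (a : R[i]) : 0 < a ->
  (forall z, root q z -> `|z| <= 1) ->
  (forall w, root p^`() w -> a <= `|w|) -> N.+1%:R^-1 <= a ^+ N ->
  [/\ a ^+ N = N.+1%:R^-1, (forall w, root p^`() w -> `|w| = a) &
     forall z, root q z -> `|z| = 1].
Proof.
move=> a0 q1 pa aN; have [h1 h2] := le_abs0_pow (ltW a0) q1 pa.
have [sp sp' lp' p'0 c0] := deriv_mulX_facts.
have n0 : 0 < N.+1%:R :> R[i] by rewrite ltr0n.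
have h3 : 1 <= N.+1%:R * a ^+ N by rewrite mulrC -ler_pdivrMr // div1r.
have q01 : `|q`_0| = 1.
  by apply/le_anti; rewrite h2 (le_trans h3 h1).
split.
- apply/le_anti; rewrite aN andbT -div1r ler_pdivlMr // mulrC.
  exact: le_trans h1 h2.
- by apply: norm_root_of_le; rewrite // norm_lead_coef_deriv sp' c0 q01.
- apply: norm_root_of_ge; rewrite ?monic_neq0 //.
  by rewrite (monicP qm) normr1 expr1n mul1r q01.
Qed.

End CriticalPoints.

Lemma abs0_crit (R : realType) (N : nat) (p : {poly R[i]}) :
  (0 < N)%N -> S0 N.+1 p ->
  exists2 w, root p^`() w & abs0 p = modulus w /\
    (forall v, root p^`() v -> `|w| <= `|v|).
Proof.
move=> N0 [_ sp _ _]; have [|w pw [E H]] := @abs0_is_min R p; first by rewrite sp.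
by exists w => //; split=> // v pv; rewrite -!modulusE lecR; exact: H.
Qed.

Lemma abs0_pow_le (R : realType) (N : nat) (p : {poly R[i]}) :
  (0 < N)%N -> S0 N.+1 p -> abs0 p ^+ N <= N.+1%:R^-1.
Proof.
move=> N0 pS; have [w _ [-> wmin]] := abs0_crit N0 pS.
have [q [pE qm sq q1]] := S0_factor pS.
have [h1 h2] := le_abs0_pow pE qm sq (normr_ge0 w) q1 wmin.
rewrite -div1r ler_pdivlMr ?ltr0n // mulrC.
by rewrite -lecR rmorphM rmorphXn rmorph_nat /= modulusE (le_trans h1 h2).
Qed.

Lemma zero_maximal_of_norms (R : realType) (N : nat) (p : {poly R[i]}) :
  (0 < N)%N -> S0 N.+1 p ->
  (forall w, root p^`() w -> `|w| ^+ N = N.+1%:R^-1) ->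
  abs0 p ^+ N = N.+1%:R^-1 /\ zero_maximal N.+1 p.
Proof.
move=> N0 pS pw; have [w rw [pE _]] := abs0_crit N0 pS.
have aE : abs0 p ^+ N = N.+1%:R^-1 by rewrite pE; apply/modulus_pow_eq/pw.
split=> //; split => // g gS; rewrite -(ler_pXn2r N0).
- by rewrite aE abs0_pow_le.
- by have [v _ [-> _]] := abs0_crit N0 gS; rewrite nnegrE modulus_ge0.
- by rewrite nnegrE pE modulus_ge0.
Qed.

Lemma norm_eq_pow1 (C : numDomainType) (z : C) (n : nat) :
  (0 < n)%N -> `|z| ^+ n = 1 -> `|z| = 1.
Proof. by move=> n0 /eqP; rewrite pexprn_eq1 // gtn_eqF //= => /eqP. Qed.

Lemma mulX_S0 (R : realType) (N : nat) (q : {poly R[i]}) :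
  q \is monic -> size q = N.+1 -> (forall z, root q z -> `|z| = 1) ->
  S0 N.+1 (q * 'X).
Proof.
move=> qm sq q1; split.
- by rewrite monicMr ?monicX.
- by rewrite size_mulX ?monic_neq0 // sq.
- move=> z; rewrite /zeros /= rootM -lecR modulusE => /orP[/q1 -> //|].
  by rewrite rootX => /eqP ->; rewrite normr0.
- by rewrite /zeros /= rootM rootX eqxx orbT.
Qed.

(** Besides giving half of the even case, this shows that the bound of [abs0_pow_le] is attained in
    every degree at least 2. *)
Lemma binomial_zero_maximal (R : realType) (N : nat) (u : R[i]) :
  (0 < N)%N -> `|u| = 1 ->
  abs0 ('X^(N.+1) + u *: 'X) ^+ N = N.+1%:R^-1 /\
  zero_maximal N.+1 ('X^(N.+1) + u *: 'X).
Proof.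
move=> N0 u1; pose q : {poly R[i]} := 'X^N + u%:P.
have -> : 'X^(N.+1) + u *: 'X = q * 'X by rewrite mulrDl exprSr mul_polyC.
have su : (size u%:P < size ('X^N : {poly R[i]}))%N.
  by rewrite size_polyXn ltnS (leq_trans (size_polyC_leq1 _)).
have sq : size q = N.+1 by rewrite size_polyDl // size_polyXn.
have qm : q \is monic by rewrite monicE lead_coefDl ?lead_coefXn.
apply: zero_maximal_of_norms => //.
  apply: mulX_S0 => // z /rootP; rewrite hornerD hornerXn hornerC => /eqP.
  rewrite addr_eq0 => /eqP zN; apply: (norm_eq_pow1 N0).
  by rewrite -normrX zN normrN.
move=> w /rootP; rewrite mulrDl mul_polyC -exprSr derivD derivXn derivZ derivX /=.
rewrite hornerD hornerMn hornerXn hornerZ hornerC mulr1 => /eqP.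
rewrite addr_eq0 => /eqP wN; have n0 : N.+1%:R != 0 :> R[i] by rewrite pnatr_eq0.
apply: (mulfI n0); rewrite mulfV // -normrX mulr_natl -normrMn wN normrN //.
Qed.

Lemma zero_maximal_norms (R : realType) (N : nat) (p : {poly R[i]}) :
  (0 < N)%N -> zero_maximal N.+1 p ->
  exists q : {poly R[i]}, [/\ p = q * 'X, q \is monic, size q = N.+1,
     (forall z, root q z -> `|z| = 1) &
     forall w, root p^`() w -> `|w| ^+ N = N.+1%:R^-1].
Proof.
move=> N0 [pS pmax]; have [q [pE qm sq q1]] := S0_factor pS; exists q.
have [w pw [aE wmin]] := abs0_crit N0 pS.
(* The competitor is z^(N+1) + z, which forces a maximal [p] to reach the bound. *)
have [bE [bS _]] := binomial_zero_maximal N0 (normr1 R[i]).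
have wge : N.+1%:R^-1 <= `|w| ^+ N.
  have -> : N.+1%:R^-1 = (N.+1%:R^-1)%:C :> R[i] by rewrite fmorphV rmorph_nat.
  rewrite -modulusE -rmorphXn lecR -bE -aE.
  rewrite ler_pXn2r ?nnegrE // ?pmax // ?aE ?modulus_ge0 //.
  by have [v _ [-> _]] := abs0_crit N0 bS; rewrite modulus_ge0.
have w0 : 0 < `|w|.
  rewrite normr_gt0; apply: contraTneq wge => ->.
  by rewrite normr0 expr0n gtn_eqF // lt_geF // invr_gt0 ltr0n.
have [aN pa qa] := extremal_zeros_norm pE qm sq w0 q1 wmin wge.
by split=> // v pv; rewrite pa.
Qed.

(** * Vanishing of the coefficients away from the ends and the middle *)

Section Coefficients.
Variables (R : realType) (N : nat) (q : {poly R[i]}).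
Hypotheses (N_gt0 : (0 < N)%N) (qm : q \is monic) (sq : size q = N.+1).
Hypothesis q1 : forall z, root q z -> `|z| = 1.
Hypothesis crit : forall w, root (q * 'X)^`() w -> `|w| ^+ N = N.+1%:R^-1.

Lemma coef_self_inversive k : (k <= N)%N -> q`_0 * Num.conj q`_(N - k) = q`_k.
Proof.
move=> kN; have := @self_inversive _ 1 q k (monic_neq0 qm).
rewrite sq (monicP qm) conjC1 expr1n mul1r mulr1; apply => //.
by move=> z qz; rewrite -normCK q1 // expr1n.
Qed.

Lemma norm_coef0 : `|q`_0| = 1.
Proof.
have qN : q`_N = 1 by have := monicP qm; rewrite lead_coefE sq.
have := coef_self_inversive (leqnn N); rewrite subnn qN -normCK => /eqP.
by rewrite sqrp_eq1 // => /eqP.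
Qed.

Lemma coef_eq0 k : (0 < k < N)%N -> (2 * k != N)%N -> q`_k = 0.
Proof.
have [sp sp' lp' p'0 c0] := deriv_mulX_facts erefl qm sq.
have [w pw] : exists w, root (q * 'X)^`() w.
  by apply/closed_rootP; rewrite sp' eqSS -lt0n.
(* All critical points have the same modulus r, and t = r^2 is the parameter for which the
   derivative is self-inversive. *)
pose t : R := modulus w ^+ 2.
have tN : t ^+ N = N.+1%:R ^- 2.
  rewrite /t exprAC; have /modulus_pow_eq -> := crit pw.
  by rewrite exprVn.
(* Indices below N/2 suffice: the symmetry k to N-k carries the result to those above. *)
have low j : (0 < j)%N -> (2 * j < N)%N -> q`_j = 0.
  move=> j0 jN; apply/eqP/negP => /negP qj0.
  apply: (symmetric_index_neq j0 jN tN); apply: (@complexI R).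
  have := @self_inversive _ t%:C _ j p'0; rewrite sp' lp'.
  have ht z : root (q * 'X)^`() z -> z * Num.conj z = t%:C.
    move=> pz; rewrite -normCK /t rmorphXn /= modulusE; congr (_ ^+ 2).
    by apply: (pexpIrn N_gt0); rewrite ?nnegrE // !crit.
  have jN' : (j <= N)%N by lia.
  move=> /(_ ht jN'); rewrite c0 !coef_deriv !coefMX /= conjC_nat => E0.
  (* The symmetry of [q] itself removes the conjugate from the symmetry of the derivative, leaving a
     relation in the single coefficient of index j. *)
  have E : q`_j *+ (N - j).+1 = N.+1%:R * (q`_j *+ j.+1) * t%:C ^+ j.
    by rewrite -E0 rmorphMn /= mulrnAr coef_self_inversive.
  apply: (mulfI qj0); rewrite !rmorphM !rmorph_nat rmorphXn /=.
  have -> : (N.+1 - j = (N - j).+1)%N by lia.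
  by rewrite [LHS]mulr_natr E -mulr_natr; ring.
move=> /andP[k0 kN] k2; have [kl|kg|] := ltngtP (2 * k)%N N; first exact: low.
- rewrite -coef_self_inversive; last lia.
  by rewrite (low (N - k)%N) ?conjC0 ?mulr0 //; lia.
- by move/eqP: k2.
Qed.

End Coefficients.

(** * Unit complex numbers and real quadratics *)

Lemma expi2 (R : realType) (t : R) : expi (2 * t) = expi t ^+ 2.
Proof.
have -> : 2 * t = t + t by ring.
rewrite /expi cosD sinD expr2; apply/eqP; rewrite eq_complex /=.
by rewrite eqxx /= addrC.
Qed.

Lemma norm_expi (R : realType) (t : R) : `|expi t| = 1.
Proof. by rewrite normc_def /= cos2Dsin2 sqrtr1. Qed.

Lemma expi_surj (R : realType) (u : R[i]) : `|u| = 1 -> exists t, u = expi t.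
Proof.
case: u => x y; rewrite normc_def /= => /complexI h.
have {}h : x ^+ 2 + y ^+ 2 = 1.
  by rewrite -[LHS]sqr_sqrtr ?addr_ge0 ?sqr_ge0 // h expr1n.
have x1 : -1 <= x <= 1.
  rewrite -ler_norml -(@ler_pXn2r _ 2) ?nnegrE // real_normK ?num_real //.
  by rewrite expr1n -h lerDl sqr_ge0.
have cx : cos (acos x) = x by apply: acosK; rewrite in_itv.
have sx : sin (acos x) = `|y|.
  by rewrite sin_acos // -h [x ^+ 2 + _]addrC addrK sqrtr_sqr.
have [y0|y0] := leP 0 y.
  by exists (acos x); rewrite /expi cx sx ger0_norm.
by exists (- acos x); rewrite /expi cosN sinN cx sx ltr0_norm // opprK.
Qed.

(* Nonpositive discriminant: the roots are conjugate, or equal and real. *)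
Lemma real_quadratic_root_norm (R : realType) (A B : R) (x : R[i]) :
  0 < A -> B ^+ 2 <= 4 * A -> A%:C * x ^+ 2 + B%:C * x + 1 = 0 ->
  `|x| ^+ 2 = (A^-1)%:C.
Proof.
case: x => a b A0 D /eqP; rewrite eq_complex /= => /andP[/eqP h1 /eqP h2].
rewrite -add_Re2_Im2 /=; congr (_%:C).
have {}h1 : A * (a ^+ 2 - b ^+ 2) + B * a + 1 = 0 by rewrite -[RHS]h1; ring.
have {}h2 : b * (2 * A * a + B) = 0 by rewrite -[RHS]h2; ring.
apply: (mulfI (lt0r_neq0 A0)); rewrite mulfV ?gt_eqF //.
(* The imaginary part gives b = 0 or the claim. If b = 0, completing the square shows that (2Aa +
   B)^2 equals the discriminant, which is at most 0. *)
have BE : B = - (2 * A * a).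
  apply/eqP; rewrite -addr_eq0 addrC; have /eqP := h2; rewrite mulf_eq0.
  case/orP => // /eqP b0; rewrite -sqrf_eq0 eq_le sqr_ge0 andbT.
  have -> : (2 * A * a + B) ^+ 2 =
    4 * A * (A * (a ^+ 2 - b ^+ 2) + B * a + 1) + (B ^+ 2 - 4 * A).
    by rewrite b0; ring.
  by rewrite h1 mulr0 add0r subr_le0.
by move: h1; rewrite BE => h1; lra.
Qed.


(** * Classification of the 0-maximal polynomials *)

(** For odd [N] no index is its own mirror image, so [coef_eq0] kills every coefficient of the
    cofactor strictly between the ends. *)
Lemma binomial_of_zero_maximal (R : realType) (N : nat) (p : {poly R[i]}) :
  odd N -> zero_maximal N.+1 p ->
  exists2 u, `|u| = 1 & p = 'X^(N.+1) + u *: 'X.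
Proof.
move=> oN pmax; have N0 : (0 < N)%N by case: N oN {pmax}.
have [q [-> qm sq q1 crit]] := zero_maximal_norms N0 pmax.
exists q`_0; first exact: norm_coef0 qm sq q1.
rewrite exprSr -mul_polyC -mulrDl; congr (_ * _); apply/polyP => k.
rewrite coefD coefXn coefC; have qN : q`_N = 1.
  by have := monicP qm; rewrite lead_coefE sq.
have [->|k0] := posnP k; first by rewrite eq_sym gtn_eqF //= add0r.
rewrite addr0; have [kN|kN|->] := ltngtP k N => /=.
- apply: (coef_eq0 N0 qm sq q1 crit); first by rewrite k0.
  by apply: contraTneq oN => <-; rewrite oddM.
- by rewrite nth_default // sq.
- by rewrite qN.
Qed.

Lemma trinomial_of_zero_maximal (R : realType) (m : nat) (p : {poly R[i]}) :
  (0 < m)%N -> zero_maximal (2 * m).+1 p ->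
  exists lambda theta : R,
    `|lambda| <= 2 * Num.sqrt (2 * m).+1%:R / m.+1%:R /\
    p = 'X^((2 * m).+1) + (lambda%:C * expi theta) *: 'X^(m.+1)
        + expi (2 * theta) *: 'X.
Proof.
move=> m0; set N := (2 * m)%N => pmax; have N0 : (0 < N)%N by rewrite /N; lia.
have [q [pE qm sq q1 crit]] := zero_maximal_norms N0 pmax.
rewrite pE in crit.
have u1 : `|q`_0| = 1 := norm_coef0 qm sq q1.
(* Halving the argument makes [e] a square root of q(0). *)
have [t2 t2E] := expi_surj u1; pose t := t2 / 2; pose e := expi t.
have uE : q`_0 = expi (2 * t) by rewrite t2E /t mulrC divfK // pnatr_eq0.
have e1 : `|e| = 1 := norm_expi t.
have ee : e * Num.conj e = 1 by rewrite -normCK e1 expr1n.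
have cE : q`_0 * Num.conj q`_m = q`_m.
  have := coef_self_inversive qm sq q1 (k := m).
  have -> : (N - m = m)%N by rewrite /N; lia.
  by apply; rewrite /N; lia.
(* The middle index is fixed by the symmetry, so the middle coefficient divided by [e] equals its
   own conjugate and is real. *)
have [l lE] : exists l : R, q`_m * Num.conj e = l%:C.
  exists (complex.Re (q`_m * Num.conj e)); rewrite RRe_real //.
  apply/CrealP; rewrite rmorphM /= conjCK -[in RHS]cE uE expi2 -/e.
  transitivity (Num.conj q`_m * e * (e * Num.conj e)); first by rewrite ee mulr1.
  by ring.
have qmE : q`_m = l%:C * e by rewrite -lE -mulrA [_ * e]mulrC ee mulr1.
have qE : q = 'X^N + q`_m *: 'X^m + (q`_0)%:P.
  apply/polyP => k; rewrite !coefD coefZ !coefXn coefC.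
  have qN : q`_N = 1 by have := monicP qm; rewrite lead_coefE sq.
  have [->|k0] := posnP k.
    by rewrite ![0%N == _]eq_sym !gtn_eqF //= mulr0 !add0r.
  rewrite addr0; have [->|km] := eqVneq k m.
    by rewrite ltn_eqF ?mulr1 ?add0r // /N; lia.
  rewrite mulr0 addr0; have [kN|kN|->] := ltngtP k N => /=.
  - apply: (coef_eq0 N0 qm sq q1 crit); first by rewrite k0.
    by apply: contraNneq km; rewrite /N; lia.
  - by rewrite nth_default // sq.
  - by rewrite qN.
have pE' : p = 'X^(N.+1) + q`_m *: 'X^(m.+1) + q`_0 *: 'X.
  by rewrite pE {1}qE !mulrDl -exprSr -scalerAl -exprSr mul_polyC.
exists l, t; split; last by rewrite pE' uE qmE.
have [sp sp' lp' p'0 c0] := deriv_mulX_facts erefl qm sq.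
have [w pw] : exists w, root (q * 'X)^`() w.
  by apply/closed_rootP; rewrite sp' eqSS -lt0n.
(* In y = w^m the critical equation is quadratic. One critical point is enough to bound lambda. *)
have wN := crit w pw; pose y := w ^+ m.
have y2 : `|y| ^+ 2 = N.+1%:R^-1 by rewrite /y normrX -exprM mulnC.
have n0 : N.+1%:R != 0 :> R[i] by rewrite pnatr_eq0.
have E : N.+1%:R * y ^+ 2 + m.+1%:R * q`_m * y + q`_0 = 0.
  move/rootP: pw; rewrite -pE pE' !derivD !derivZ !derivXn derivX /=.
  rewrite !hornerD !hornerZ !hornerMn !hornerXn hornerC mulr1 => Ew; rewrite -[RHS]Ew.
  have -> : y ^+ 2 = w ^+ N by rewrite /y -exprM mulnC.
  by rewrite -[w ^+ N *+ _]mulr_natl -[w ^+ m *+ _]mulr_natl /y; ring.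
(* With the middle term isolated, each of the other two has modulus 1, because |y|^2 = 1/(N+1). *)
have E1 : m.+1%:R * `|q`_m| * `|y| <= 2.
  have -> : m.+1%:R * `|q`_m| * `|y| = `|N.+1%:R * y ^+ 2 + q`_0|.
    move/eqP: E; rewrite addrAC addrC addr_eq0 => /eqP E.
    by rewrite -[RHS]normrN -E !normrM normr_nat.
  apply: le_trans (ler_normD _ _) _.
  by rewrite u1 normrM normr_nat normrX y2 mulfV.
have nl : `|q`_m| = `|l|%:C by rewrite qmE normrM e1 mulr1 normc_def /= expr0n addr0 sqrtr_sqr.
have E2 : (m.+1%:R * `|l|) ^+ 2 / N.+1%:R <= 2 ^+ 2 :> R.
  rewrite -lecR rmorphM fmorphV !rmorphXn rmorphM !rmorph_nat /= -nl -y2 -exprMn.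
  by rewrite ler_pXn2r // nnegrE ?mulr_ge0.
rewrite ler_pdivlMr ?ltr0n // mulrC -(@ler_pXn2r _ 2) ?nnegrE ?mulr_ge0 ?sqrtr_ge0 //.
by rewrite [leRHS]exprMn sqr_sqrtr // -ler_pdivrMr ?ltr0n.
Qed.

Lemma trinomial_zero_maximal (R : realType) (m : nat) (l t : R) :
  (0 < m)%N -> `|l| <= 2 * Num.sqrt (2 * m).+1%:R / m.+1%:R ->
  zero_maximal (2 * m).+1 ('X^((2 * m).+1) + (l%:C * expi t) *: 'X^(m.+1)
    + expi (2 * t) *: 'X).
Proof.
move=> m0 lb; set N := (2 * m)%N; have N0 : (0 < N)%N by rewrite /N; lia.
set e := expi t; set c := l%:C * e; rewrite expi2 -/e.
have e1 : `|e| = 1 := norm_expi t.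
have e0 : e != 0 by rewrite -normr_eq0 e1 oner_eq0.
pose r : {poly R[i]} := c *: 'X^m + (e ^+ 2)%:P.
pose q : {poly R[i]} := 'X^N + r.
have qE : 'X^(N.+1) + c *: 'X^(m.+1) + e ^+ 2 *: 'X = q * 'X.
  by rewrite /q /r !mulrDl -scalerAl -!exprSr mul_polyC addrA.
rewrite qE; have sr : (size r < size ('X^N : {poly R[i]}))%N.
  rewrite size_polyXn ltnS (leq_trans (size_polyD _ _)) // geq_max.
  rewrite (leq_trans (size_scale_leq _ _)) ?size_polyXn; last by rewrite /N; lia.
  by rewrite (leq_trans (size_polyC_leq1 _)).
have sq : size q = N.+1 by rewrite size_polyDl // size_polyXn.
have qm : q \is monic by rewrite monicE lead_coefDl ?lead_coefXn.
(* The bound on lambda, squared, says exactly that the quadratic for the critical points has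
   nonpositive discriminant. *)
have D : (m.+1%:R * l) ^+ 2 <= 4 * N.+1%:R.
  move: lb; rewrite ler_pdivlMr ?ltr0n // mulrC => lb.
  have -> : (m.+1%:R * l) ^+ 2 = (m.+1%:R * `|l|) ^+ 2.
    by rewrite !exprMn real_normK ?num_real.
  have -> : 4 * N.+1%:R = (2 * Num.sqrt N.+1%:R) ^+ 2 :> R.
    by rewrite exprMn sqr_sqrtr // -natrX.
  by rewrite ler_pXn2r ?nnegrE ?mulr_ge0 ?sqrtr_ge0.
(* The discriminant condition for the zeros follows from the previous one, as 2m+1 <= (m+1)^2. *)
have D1 : l ^+ 2 <= 4 * 1.
  have m1 : 0 < m.+1%:R ^+ 2 :> R by rewrite exprn_gt0 // ltr0n.
  rewrite -(ler_pM2l m1) -exprMn; apply: le_trans D _.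
  rewrite mulr1 mulrC ler_pM2r // -natrX ler_nat /N; lia.
(* The rotation y = e x makes the coefficients real. It is used with A = 1, B = l for the zeros and
   A = N+1, B = (m+1) l for the critical points. *)
have rotated A B (y : R[i]) : 0 < A -> B ^+ 2 <= 4 * A ->
    A%:C * y ^+ 2 + B%:C * e * y + e ^+ 2 = 0 -> `|y| ^+ 2 = (A^-1)%:C.
  move=> A0 AB E; rewrite -(real_quadratic_root_norm A0 AB (x := y / e)).
    by rewrite normrM normfV e1 invr1 mulr1.
  by apply: (mulfI (expf_neq0 2 e0)); rewrite mulr0 -E; field.
apply: (zero_maximal_of_norms N0 _ _).2.
  apply: mulX_S0 => // z /rootP.
  rewrite !hornerD hornerZ !hornerXn hornerC => E.
  apply: (norm_eq_pow1 N0); rewrite /N mulnC exprM -normrX.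
  rewrite (rotated 1 l) ?invr1 // -exprM [(m * 2)%N]mulnC mul1r -addrA.
  exact: E.
move=> w /rootP; rewrite -qE !derivD !derivZ !derivXn derivX /=.
rewrite !hornerD !hornerZ !hornerMn !hornerXn hornerC mulr1 => E.
rewrite {1}/N mulnC exprM -normrX (rotated N.+1%:R (m.+1%:R * l)) ?ltr0n //.
  by rewrite fmorphV rmorph_nat.
have -> : (w ^+ m) ^+ 2 = w ^+ N by rewrite -exprM mulnC.
rewrite -[RHS]E rmorphM !rmorph_nat /c.
by rewrite -[w ^+ N *+ _]mulr_natl -[w ^+ m *+ _]mulr_natl; ring.
Qed.

Theorem theorem1 (R : realType) (n : nat) (hn : (2 <= n)%N) :
  (forall m : nat, (1 <= m)%N -> n = (2 * m)%N ->
     forall p : {poly R[i]},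
       zero_maximal n p <->
       exists theta : R, p = 'X^(2 * m) + expi (2 * theta) *: 'X)
  /\
  (forall m : nat, (1 <= m)%N -> n = (2 * m).+1 ->
     forall p : {poly R[i]},
       zero_maximal n p <->
       exists lambda theta : R,
         `|lambda| <= 2 * Num.sqrt (2 * m).+1%:R / m.+1%:R /\
         p = 'X^((2 * m).+1) + (lambda%:C * expi theta) *: 'X^(m.+1)
             + expi (2 * theta) *: 'X).
Proof.
split=> m m0 -> p; last first.
  split; first exact: trinomial_of_zero_maximal.
  by move=> [l [t [lb ->]]]; exact: trinomial_zero_maximal.
(* This exposes N = 2m - 1, which is odd, as the degree of the cofactor. *)
have -> : (2 * m = (2 * m).-1.+1)%N by lia.
split=> [pmax|[t ->]]; last first.
  by apply: (binomial_zero_maximal _ _).2; rewrite ?norm_expi //; lia.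
have [|u /expi_surj[t ->] ->] := binomial_of_zero_maximal _ pmax.
  by rewrite -subn1 oddB ?oddM //; lia.
by exists (t / 2); rewrite [2 * _]mulrC divfK // pnatr_eq0.
Qed.
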